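(* Let $\mathcal H$ be a real separable Hilbert space with $\dim\mathcal H=\infty$, and let $(b_k)_{k\in\mathbb N}$ be an arbitrary orthonormal basis of $\ell^2(\mathbb R)$. Then for every $f\in\ell^2(\mathcal H)$ we have $$f=\sum_{k=1}^\infty [f,b_k]\bullet b_k$$ (convergence in $\ell^2(\mathcal H)$). In particular $\|f\|_{\ell^2(\mathcal H)}^2=\sum_{k=1}^\infty\|[f,b_k]\|_{\mathcal H}^2$.
   Context: $\ell^2(\mathcal H)$ is the Hilbert space of sequences $f=(f_k)_{k\in\mathbb N}$ in $\mathcal H$ with $\sum_{k=1}^\infty\|f_k\|_{\mathcal H}^2<\infty$, with inner product $(f,g)_{\ell^2(\mathcal H)}=\sum_{k=1}^\infty(f_k,g_k)_{\mathcal H}$. For $h\in\mathcal H$, $x\in\ell^2(\mathbb R)$ and $f\in\ell^2(\mathcal H)$ put $h\bullet x:=(x_kh)_{k\in\mathbb N}\in\ell^2(\mathcal H)$ and $[f,x]:=\sum_{k=1}^\infty x_kf_k\in\mathcal H$ (the series converges in $\mathcal H$). Here $\mathbb N=\{1,2,\dots\}$. *)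

(* Defs.v *)
From HB Require Import structures.
From mathcomp Require Import all_boot all_order all_algebra.
From mathcomp Require Import all_classical all_reals all_analysis.
From mathcomp Require Import sesquilinear ring lra.

Set Implicit Arguments.
Unset Strict Implicit.
Unset Printing Implicit Defensive.

Import Order.TTheory GRing.Theory Num.Theory.
Import numFieldNormedType.Exports.

Local Open Scope classical_set_scope.
Local Open Scope ring_scope.

HB.mixin Record NormedModule_hasInner (R : realType) H
    & NormedModule R H := {
  inner : {dot H for (@idfun R)} ;
  inner_norm : forall x : H, inner x x = `|x| ^+ 2
}.

#[short(type="preHilbertType")]
HB.structure Definition PreHilbert (R : realType) :=
  {H of NormedModule R H & NormedModule_hasInner R H}.

#[short(type="hilbertType")]
HB.structure Definition Hilbert (R : realType) :=
  {H of CompleteNormedModule R H & NormedModule_hasInner R H}.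

Section DotTheory.
Variables (R : realType) (M : lmodType R) (dot : {dot M for (@idfun R)}).
Implicit Types x y : M.

Lemma dotC x y : dot x y = dot y x.
Proof. by rewrite hermC/= expr0 mul1r. Qed.

Lemma dot_ge0 x : 0 <= dot x x.
Proof.
by have [->|x0] := eqVneq x 0; [rewrite linear0l|exact/ltW/neq0_dnorm_gt0].
Qed.

Lemma dotZl a x y : dot (a *: x) y = a * dot x y.
Proof. exact: linearZl_LR. Qed.

Lemma dotZr a x y : dot x (a *: y) = a * dot x y.
Proof. exact: linearZr_LR. Qed.

Lemma dotD x y : dot (x + y) (x + y) = dot x x + dot y y + dot x y *+ 2.
Proof.
by rewrite linearDl/= !linearDr/= (dotC y x) mulr2n; ring.
Qed.

Lemma dotZ a x : dot (a *: x) (a *: x) = a ^+ 2 * dot x x.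
Proof. by rewrite dotZl dotZr mulrA expr2. Qed.

Lemma dot_CauchySchwarz x y : dot x y ^+ 2 <= dot x x * dot y y.
Proof.
have [->|y0] := eqVneq y 0; first by rewrite (linear0r dot x) (linear0r dot 0) expr0n/= mulr0.
have yy := @neq0_dnorm_gt0 _ _ _ dot y y0.
have := dot_ge0 (dot y y *: x + (- dot x y) *: y).
rewrite dotD !dotZ dotZl dotZr.
rewrite (_ : _ + _ = dot y y * (dot x x * dot y y - dot x y ^+ 2)); last by ring.
by rewrite pmulr_rge0// subr_ge0.
Qed.

Definition dot_norm x := Num.sqrt (dot x x).

Lemma dot_normD x y : dot_norm (x + y) <= dot_norm x + dot_norm y.
Proof.
rewrite -(@ler_pXn2r _ 2%N)// ?nnegrE ?addr_ge0 ?sqrtr_ge0//.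
rewrite sqrrD !sqr_sqrtr ?dot_ge0// dotD addrAC lerD2r// lerD2l.
rewrite lerMn2r/= -sqrtrM ?dot_ge0//.
by rewrite (le_trans (ler_norm _))// -sqrtr_sqr ler_wsqrtr// dot_CauchySchwarz.
Qed.

Lemma dot_normZ a x : dot_norm (a *: x) = `|a| * dot_norm x.
Proof. by rewrite /dot_norm dotZ sqrtrM ?sqr_ge0// sqrtr_sqr. Qed.

Lemma dot_norm_eq0 x : dot_norm x = 0 -> x = 0.
Proof.
move/eqP; rewrite sqrtr_eq0 => xx; apply/eqP; apply: contraTT xx => x0.
by rewrite -ltNge neq0_dnorm_gt0.
Qed.

End DotTheory.

(* Builds a pre-Hilbert space whose norm is the one induced by [dot]. *)
HB.factory Record Lmodule_hasDot (R : realType) H & GRing.Lmodule R H := {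
  dot : {dot H for (@idfun R)}
}.

HB.builders Context (R : realType) H & Lmodule_hasDot R H.

HB.instance Definition _ := Lmodule_isNormed.Build R H
  (dot_normD dot) (dot_normZ dot) (@dot_norm_eq0 _ _ dot).

Let dot_dot_norm (x : H) : dot x x = `|x| ^+ 2.
Proof. by rewrite sqr_sqrtr// dot_ge0. Qed.

HB.instance Definition _ := NormedModule_hasInner.Build R H dot_dot_norm.

HB.end.

Section RealHilbert.
Variable R : realType.

Definition real_inner (x y : R^o) : R := x * y.

Let real_inner_bilinear : bilinear_for *%R (@idfun R \; *%R) real_inner.
Proof.
split=> [y a u v|x a u v]; rewrite /real_inner /=.
  by rewrite mulrDl -mulrA.
by rewrite mulrDr mulrCA.
Qed.

HB.instance Definition _ :=
  bilinear_isBilinear.Build R R^o R^o R *%R (@idfun R \; *%R) real_inner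
    real_inner_bilinear.

Let real_inner_sym x y : real_inner x y = (-1) ^+ false * @idfun R (real_inner y x).
Proof. by rewrite expr0 mul1r /real_inner mulrC. Qed.

HB.instance Definition _ :=
  isHermitianSesquilinear.Build R R^o false (@idfun R) real_inner real_inner_sym.

Let real_inner_gt0 (x : R^o) : x != 0 -> 0 < real_inner x x.
Proof. by move=> x0; rewrite /real_inner -expr2 exprn_even_gt0. Qed.

HB.instance Definition _ :=
  isDotProduct.Build R R^o real_inner real_inner_gt0.

Let real_inner_norm (x : R^o) : real_inner x x = `|x| ^+ 2.
Proof. by rewrite real_normK ?num_real// expr2. Qed.

HB.instance Definition _ :=
  NormedModule_hasInner.Build R R^o real_inner_norm.

End RealHilbert.

Lemma inner_CauchySchwarz (R : realType) (H : preHilbertType R) (x y : H) :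
  `|inner x y| <= `|x| * `|y|.
Proof.
rewrite -(@ler_pXn2r _ 2%N)// ?nnegrE ?mulr_ge0//.
by rewrite exprMn -!inner_norm real_normK ?num_real// dot_CauchySchwarz.
Qed.

Section SqSummable.
Variables (R : realType) (H : normedModType R).

Definition sqsummable : {pred nat -> H} :=
  mem [set f : nat -> H | cvgn (series (fun k => `|f k| ^+ 2))].

Lemma sqsummableP (f : nat -> H) :
  f \in sqsummable <-> cvgn (series (fun k => `|f k| ^+ 2)).
Proof. by rewrite inE. Qed.

Lemma sqsummable_submod_closed : submod_closed sqsummable.
Proof.
split=> [|a f g /sqsummableP cf /sqsummableP cg]; apply/sqsummableP.
  apply: (@series_le_cvg _ _ (fun=> 0)) => //.
    by move=> n; rewrite normr0 expr0n.
  rewrite (_ : series _ = cst 0); first exact: is_cvg_cst.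
  by apply/funext => n; rewrite /series/= big1.
have := is_cvg_seriesD (is_cvg_seriesZ (k := 2 * `|a| ^+ 2) cf)
  (is_cvg_seriesZ (k := 2) cg).
apply: series_le_cvg => n; first exact: exprn_ge0.
  by apply: addr_ge0; apply: mulr_ge0 => //; apply: mulr_ge0.
rewrite (_ : _ n = 2 * `|a| ^+ 2 * `|f n| ^+ 2 + 2 * `|g n| ^+ 2)//.
have /le_trans -> // : `|a *: f n + g n| ^+ 2 <= (`|a| * `|f n| + `|g n|) ^+ 2.
  by rewrite lerXn2r ?nnegrE ?addr_ge0 ?mulr_ge0// -normrZ ler_normD.
have := sqr_ge0 (`|a| * `|f n| - `|g n|).
by rewrite sqrrB sqrrD !exprMn; lra.
Qed.

HB.instance Definition _ := GRing.isSubmodClosed.Build _ _ sqsummable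
  sqsummable_submod_closed.

Lemma sqsummable_mul (a : nat -> R^o) (f : nat -> H) :
  cvgn (series (fun k => `|a k| ^+ 2)) -> cvgn (series (fun k => `|f k| ^+ 2)) ->
  cvgn (series (fun k => `|a k| * `|f k|)).
Proof.
move=> ca cf; apply: series_le_cvg (is_cvg_seriesD ca cf) => n.
- exact: mulr_ge0.
- by apply: addr_ge0; exact: exprn_ge0.
have := sqr_ge0 (`|a n| - `|f n|).
have : 0 <= `|a n| * `|f n| by exact: mulr_ge0.
by rewrite sqrrB (_ : (_ + _) n = `|a n| ^+ 2 + `|f n| ^+ 2)//; lra.
Qed.

End SqSummable.

Section L2.
Variables (R : realType) (H : preHilbertType R).

(* Sequences are indexed from 0.  Scalar sequences are the instance [l2 R^o]:
   [R^o] is the field [R] regarded as a Hilbert space over itself. *)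
Record l2 := L2 { l2_val :> nat -> H ; l2P : l2_val \in @sqsummable R H }.

HB.instance Definition _ := [isSub for l2_val].
HB.instance Definition _ := [Choice of l2 by <:].
HB.instance Definition _ := [SubChoice_isSubLmodule of l2 by <:].

Implicit Types f g : l2.

Lemma is_cvg_l2_norm f : cvgn (series (fun k => `|f k| ^+ 2)).
Proof. exact/sqsummableP/l2P. Qed.
Arguments is_cvg_l2_norm : clear implicits.

Lemma is_cvg_l2_inner f g : cvgn (series (fun k => inner (f k) (g k))).
Proof.
apply: (@normed_cvg _ R^o).
have := @sqsummable_mul R H (fun k => `|f k|) g.
under eq_fun do rewrite normr_id.
move=> /(_ (is_cvg_l2_norm f) (is_cvg_l2_norm g)).
apply: series_le_cvg => n; [exact: normr_ge0|exact: mulr_ge0|].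
by rewrite normr_id inner_CauchySchwarz.
Qed.
Arguments is_cvg_l2_inner : clear implicits.

Definition l2_inner f g : R := limn (series (fun k => inner (f k) (g k))).

Let l2_inner_linear g a f f' :
  l2_inner (a *: f + f') g = a * l2_inner f g + l2_inner f' g.
Proof.
rewrite /l2_inner -[a * _]/(a *: (_ : R^o)) -(lim_seriesZ a (is_cvg_l2_inner f g)).
rewrite -(lim_seriesD (is_cvg_seriesZ (k := a) (is_cvg_l2_inner f g)))//.
  congr (limn (series _)); apply/funext => k.
  by rewrite linearDl/= dotZl.
exact: is_cvg_l2_inner.
Qed.

Let l2_innerC f g : l2_inner f g = l2_inner g f.
Proof.
by congr (limn (series _)); apply/funext => k; rewrite dotC.
Qed.

Let l2_inner_bilinear : bilinear_for *%R (@idfun R \; *%R) l2_inner.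
Proof.
split=> [g a f f'|f a g g'] /=; first exact: l2_inner_linear.
by rewrite l2_innerC l2_inner_linear !(l2_innerC f).
Qed.

HB.instance Definition _ :=
  bilinear_isBilinear.Build R l2 l2 R *%R (@idfun R \; *%R) l2_inner
    l2_inner_bilinear.

Let l2_inner_sym f g : l2_inner f g = (-1) ^+ false * @idfun R (l2_inner g f).
Proof. by rewrite expr0 mul1r l2_innerC. Qed.

HB.instance Definition _ :=
  isHermitianSesquilinear.Build R l2 false (@idfun R) l2_inner l2_inner_sym.

Lemma l2_partial_le f n : \sum_(0 <= k < n) `|f k| ^+ 2 <= l2_inner f f.
Proof.
rewrite (_ : l2_inner f f = limn (series (fun k => `|f k| ^+ 2))); last first.
  by congr (limn (series _)); apply/funext => k; rewrite inner_norm.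
apply: (@nondecreasing_cvgn_le R (series (fun k => `|f k| ^+ 2))).
  by apply: nondecreasing_series => k _ _; exact: exprn_ge0.
exact: is_cvg_l2_norm.
Qed.

Lemma l2_coord_le f k : `|f k| ^+ 2 <= l2_inner f f.
Proof.
apply: le_trans (l2_partial_le f k.+1).
by rewrite big_nat_recr//= lerDr sumr_ge0// => i _; exact: exprn_ge0.
Qed.

Let l2_inner_gt0 f : f != 0 -> 0 < l2_inner f f.
Proof.
apply: contra_neqT; rewrite -leNgt => f0.
apply/val_inj/funext => k /=; apply/normr0_eq0/eqP.
rewrite -sqrf_eq0 eq_le exprn_ge0// andbT.
exact: le_trans (l2_coord_le f k) f0.
Qed.

HB.instance Definition _ := isDotProduct.Build R l2 l2_inner l2_inner_gt0.

HB.instance Definition _ := Lmodule_hasDot.Build R l2 l2_inner.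

Lemma l2_innerE f g : inner f g = limn (series (fun k => inner (f k) (g k))).
Proof. by []. Qed.

Lemma l2_normE f : `|f| ^+ 2 = limn (series (fun k => `|f k| ^+ 2)).
Proof.
rewrite -inner_norm l2_innerE.
by congr (limn (series _)); apply/funext => k; rewrite inner_norm.
Qed.

End L2.

Arguments is_cvg_l2_norm {R H} f.
Arguments is_cvg_l2_inner {R H} f g.

Section L2Complete.
Variables (R : realType) (H : hilbertType R).

Lemma l2_sum_le (f : l2 H) n : \sum_(0 <= k < n) `|f k| ^+ 2 <= `|f| ^+ 2.
Proof. by rewrite -inner_norm; exact: l2_partial_le. Qed.

Lemma l2_coord_norm (f : l2 H) k : `|f k| <= `|f|.
Proof.
by rewrite -(@ler_pXn2r _ 2%N)// ?nnegrE// -[leRHS]inner_norm; exact: l2_coord_le.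
Qed.

Lemma sqsummable_bound (u : nat -> H) (M : R) :
  (forall n, \sum_(0 <= k < n) `|u k| ^+ 2 <= M) -> u \in @sqsummable R H.
Proof.
move=> uM; apply/sqsummableP; apply: nondecreasing_is_cvgn.
  by apply: nondecreasing_series => k _ _; exact: exprn_ge0.
by exists M => _ [n _ <-]; exact: uM.
Qed.

Lemma l2_norm_le (f : l2 H) (e : R) : 0 <= e ->
  (forall n, \sum_(0 <= k < n) `|f k| ^+ 2 <= e ^+ 2) -> `|f| <= e.
Proof.
move=> e0 fe; rewrite -(@ler_pXn2r _ 2%N)// ?nnegrE// l2_normE.
by apply: limr_le; [exact: is_cvg_l2_norm|exact: nearW].
Qed.

Lemma l2_complete (F : set_system (l2 H)) : ProperFilter F -> cauchy F -> cvg F.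
Proof.
move=> FF /cauchy_ballP Fc.
have {}Fc (e : R) : 0 < e ->
    \forall x \near F, \forall y \near F, `|x - y| < e.
  move=> e0; have [[A B] /= [FA FB] AB] := Fc _ e0.
  apply: filterS FA => x Ax; apply: filterS FB => y By.
  by have := AB (x, y) (conj Ax By); rewrite -ball_normE.
have Fcoord k : cvg ((fun x : l2 H => x k) @ F).
  apply/cauchy_cvgP/cauchyP => e e0.
  have [x Fx] := filter_ex (Fc _ e0).
  exists (x k); apply: filterS Fx => y xye.
  rewrite -ball_normE/=; apply: le_lt_trans xye.
  exact: (l2_coord_norm (x - y) k).
pose g k : H := lim ((fun x : l2 H => x k) @ F).
have Fg (x : l2 H) (e : R) : 0 < e -> (\forall y \near F, `|x - y| < e) ->
    forall n, \sum_(0 <= k < n) `|x k - g k| ^+ 2 <= e ^+ 2.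
  move=> e0 Fxe n.
  have Fs : (fun y : l2 H => \sum_(0 <= k < n) `|x k - y k| ^+ 2 : R) @ F -->
      (\sum_(0 <= k < n) `|x k - g k| ^+ 2 : R).
    elim: n => [|n ih].
      by under eq_fun do rewrite big_geq//; rewrite big_geq//; exact: cvg_cst.
    under eq_fun do rewrite big_nat_recr//=.
    rewrite big_nat_recr//=; apply: cvgD => //.
    have h : (fun y : l2 H => `|x n - y n|) @ F --> `|x n - g n|.
      apply: cvg_norm; apply: cvgB; first exact: cvg_cst.
      exact: Fcoord.
    by under eq_fun do rewrite expr2; rewrite expr2; apply: cvgM.
  apply: (ler_cvg_to Fs (cvg_cst (e ^+ 2))).
  apply: filterS Fxe => y xye.
  apply: (le_trans (l2_sum_le (x - y) n)).
  by rewrite ler_pXn2r ?nnegrE ?(ltW e0) ?(ltW xye).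
have gP : g \in @sqsummable R H.
  have [x /(Fg x 1 ltr01) h] := filter_ex (Fc 1 ltr01).
  rewrite (_ : g = l2_val x - (l2_val x - g)); last first.
    by rewrite opprB addrCA subrr addr0.
  by rewrite rpredB ?l2P// (sqsummable_bound h).
apply/cvg_ex; exists (L2 gP).
apply/cvgrPdist_le => e e0.
have := Fc _ e0; apply: filterS => x /(Fg x _ e0) h.
by rewrite distrC; apply: l2_norm_le => //; exact: ltW.
Qed.

HB.instance Definition _ := Uniform_isComplete.Build (l2 H) l2_complete.

End L2Complete.

Section Bullet.
Variables (R : realType) (H : preHilbertType R).

Lemma sqsummable_bullet (h : H) (x : l2 R^o) :
  (fun k => x k *: h) \in @sqsummable R H.
Proof.
apply/sqsummableP.
rewrite (_ : series _ = series (`|h| ^+ 2 *: (fun k => `|x k| ^+ 2 : R^o))).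
  by apply: is_cvg_seriesZ; exact: (is_cvg_l2_norm x).
by congr series; apply/funext => k; rewrite normrZ exprMn mulrC.
Qed.

Definition bullet (h : H) (x : l2 R^o) : l2 H := L2 (sqsummable_bullet h x).

Definition bracket (f : l2 H) (x : l2 R^o) : H :=
  limn (series (fun k => x k *: f k)).

End Bullet.

(* The limit in [bracket] is a junk value for divergent series; over a Hilbert
   space the series always converges. *)
Lemma cvg_bracket (R : realType) (H : hilbertType R) (f : l2 H) (x : l2 R^o) :
  series (fun k => x k *: f k) @ \oo --> bracket f x.
Proof.
suff : cvgn (series (fun k => x k *: f k)) by [].
apply: normed_cvg.
rewrite (_ : [normed series _] = series (fun k => `|x k| * `|f k|)).
  exact: sqsummable_mul (is_cvg_l2_norm x) (is_cvg_l2_norm f).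
by apply/funext => n; apply: eq_bigr => k _ /=; rewrite normrZ.
Qed.

Definition separable (T : topologicalType) : Prop :=
  exists2 D : set T, countable D & dense D.

Definition finite_dimensional (R : realType) (V : lmodType R) : Prop :=
  exists (n : nat) (e : 'I_n -> V), forall v : V,
    exists c : 'I_n -> R, v = \sum_(i < n) c i *: e i.

(* Zero coefficients are allowed, so initial segments give the whole span. *)
Definition linear_span (R : realType) (V : lmodType R) (e : nat -> V) : set V :=
  [set v | exists (n : nat) (c : nat -> R), v = \sum_(k < n) c k *: e k].

(* The closed linear span is the whole space. *)
Definition orthonormal_basis (R : realType) (H : preHilbertType R)
    (e : nat -> H) : Prop :=
  (forall i j : nat, inner (e i) (e j) = (i == j)%:R) /\ dense (linear_span e).

(* Main.v *)
(* For an orthonormal sequence b of l2 R^o, the vectors h • b_k behave like an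
   orthogonal system with "coefficients" [f, b_k]: since (f, h • x) = ([f, x], h)
   and (h • x, g • y) = (h, g) (x, y), the partial sums of the expansion are the
   best approximations of f by sums of h_k • b_k.  It thus suffices to
   approximate f by such sums.  Density of the span of b handles f = h • x, and
   the sums of f_j • δ_j, δ the standard basis, converge to f by the
   same distance formula, because [f, δ_j] = f_j. *)
Require Import Defs.
From mathcomp Require Import all_boot all_order all_algebra.
From mathcomp Require Import all_classical all_reals all_analysis.
From mathcomp Require Import sesquilinear ring.
Import Order.TTheory GRing.Theory Num.Theory.
Import numFieldNormedType.Exports.
Local Open Scope classical_set_scope.
Local Open Scope ring_scope.

Lemma normB_sqr (R : realType) (H : preHilbertType R) (x y : H) :
  `|x - y| ^+ 2 = `|x| ^+ 2 + `|y| ^+ 2 - 2 * inner x y.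
Proof.
rewrite -!inner_norm -scaleN1r dotD dotZ dotZr mulr2n; ring.
Qed.

Lemma cvg_innerl (R : realType) (H : preHilbertType R) (u : nat -> H) (l h : H) :
  u @ \oo --> l -> (fun n => inner (u n) h : R) @ \oo --> (inner l h : R).
Proof.
move=> ul; apply/(@cvgrPdist_le R R^o) => e e0.
(* The summand 1 keeps the denominator positive when [h] is zero. *)
have e1 : 0 < e / (`|h| + 1) by rewrite divr_gt0// ltr_wpDl.
move/cvgrPdist_le : ul => /(_ _ e1); apply: filterS => n lun.
rewrite -[X in X <= _]/`|inner l h - inner (u n) h| -linearBl/=.
apply: (le_trans (inner_CauchySchwarz _ _)).
have h1 : 0 < `|h| + 1 by rewrite ltr_wpDl.
rewrite ler_pdivlMr// in lun; apply: le_trans lun.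
by rewrite ler_wpM2l// lerDl.
Qed.

Lemma cvg_series_single (R : realType) (V : normedModType R) (u : nat -> V)
    (j : nat) :
  (forall k, k != j -> u k = 0) -> series u @ \oo --> u j.
Proof.
move=> u0; apply: cvg_near_cst; exists j.+1 => // n /= jn.
rewrite /series /= (bigD1_seq j)/= ?mem_index_iota ?iota_uniq//.
by rewrite big1 ?addr0.
Qed.

Section BulletBracket.
Variables (R : realType).

Lemma bulletDl (H : preHilbertType R) (h g : H) (x : l2 R^o) :
  bullet (h + g) x = bullet h x + bullet g x.
Proof. by apply/val_inj/funext => k; exact: scalerDr. Qed.

Lemma bulletDr (H : preHilbertType R) (h : H) (x y : l2 R^o) :
  bullet h (x + y) = bullet h x + bullet h y.
Proof. by apply/val_inj/funext => k; exact: scalerDl. Qed.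

Lemma bulletBr (H : preHilbertType R) (h : H) (x y : l2 R^o) :
  bullet h (x - y) = bullet h x - bullet h y.
Proof. by apply/val_inj/funext => k; exact: scalerBl. Qed.

Lemma bulletZr (H : preHilbertType R) (h : H) (a : R) (x : l2 R^o) :
  bullet h (a *: x) = bullet (a *: h) x.
Proof.
apply/val_inj/funext => k /=.
by rewrite scalerA mulrC.
Qed.

Lemma bullet_sumr (H : preHilbertType R) (h : H) (b : nat -> l2 R^o)
    (c : nat -> R) n :
  bullet h (\sum_(k < n) c k *: b k) = \sum_(0 <= k < n) bullet (c k *: h) (b k).
Proof.
rewrite big_mkord; elim: n => [|n ih].
  by rewrite !big_ord0; apply/val_inj/funext => k; exact: scale0r.
by rewrite !big_ord_recr/= -ih bulletDr bulletZr.
Qed.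

Lemma inner_bullet (H : preHilbertType R) (h g : H) (x y : l2 R^o) :
  inner (bullet h x) (bullet g y) = inner h g * inner x y.
Proof.
rewrite !l2_innerE -[RHS]/(inner h g *: (_ : R^o)).
rewrite -(lim_seriesZ _ (is_cvg_l2_inner x y)).
congr (limn (series _)); apply/funext => k /=.
rewrite dotZl dotZr -[RHS]/(inner h g * (x k * y k)).
by rewrite mulrA mulrC.
Qed.

Lemma norm_bullet (H : preHilbertType R) (h : H) (x : l2 R^o) :
  `|bullet h x| = `|h| * `|x|.
Proof.
apply/eqP; rewrite -(@eqrXn2 _ 2%N)// ?mulr_ge0//.
by rewrite exprMn -!inner_norm inner_bullet.
Qed.

(** Termwise, [x k] moves from the second argument to the first; continuity of [inner] in its first
    argument then takes the limit inside. *)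
Lemma inner_bulletr (H : hilbertType R) (f : l2 H) (h : H) (x : l2 R^o) :
  inner f (bullet h x) = inner (bracket f x) h.
Proof.
rewrite l2_innerE; apply/(@cvg_lim R^o) => //.
have := cvg_innerl _ _ _ _ h (cvg_bracket (f := f) (x := x)).
apply: cvg_trans; apply: near_eq_cvg; apply: nearW => n.
rewrite /series /= linear_sumlz/=.
by apply: eq_bigr => k _; rewrite dotZl dotZr.
Qed.

End BulletBracket.

Section Orthonormal.
Variables (R : realType) (H : hilbertType R) (b : nat -> l2 R^o).
Hypothesis b_on : forall i j : nat, inner (b i) (b j) = (i == j)%:R.

(** Each new term is orthogonal to the earlier ones, so its only cross term is
    [inner (bracket f (b n)) (h n)]; completing the square separates the choice of [h n] from the
    rest. *)
Lemma dist_bullet_sum (f : l2 H) (h : nat -> H) n :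
  `|f - \sum_(0 <= k < n) bullet (h k) (b k)| ^+ 2 =
  `|f| ^+ 2 - \sum_(0 <= k < n) `|bracket f (b k)| ^+ 2
  + \sum_(0 <= k < n) `|bracket f (b k) - h k| ^+ 2.
Proof.
elim: n => [|n ih]; first by rewrite !big_geq// !subr0 addr0.
have orth : inner (\sum_(0 <= k < n) bullet (h k) (b k)) (bullet (h n) (b n)) = 0.
  rewrite linear_sumlz big1_seq// => k /=.
  rewrite mem_index_iota => /andP[_ kn].
  apply: etrans (inner_bullet _ _ _ _ _ _) _.
  by rewrite b_on ltn_eqF// mulr0.
rewrite !big_nat_recr//= opprD addrA normB_sqr ih normB_sqr linearBl.
rewrite [X in _ * (X - _)]inner_bulletr [X in _ * (_ - X)]orth subr0.
by rewrite norm_bullet exprMn -[`|b n| ^+ 2]inner_norm b_on eqxx mulr1; ring.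
Qed.

Lemma dist_bracket_sum (f : l2 H) n :
  `|f - \sum_(0 <= k < n) bullet (bracket f (b k)) (b k)| ^+ 2 =
  `|f| ^+ 2 - \sum_(0 <= k < n) `|bracket f (b k)| ^+ 2.
Proof.
rewrite dist_bullet_sum [X in _ + X]big1 ?addr0// => k _.
by rewrite subrr normr0 expr0n.
Qed.

(** Allowing [m] beyond [n] lets a single good approximation control all later partial sums, which
    is what convergence requires. *)
Lemma bracket_sum_best (f : l2 H) (h : nat -> H) n m : (n <= m)%N ->
  `|f - \sum_(0 <= k < m) bullet (bracket f (b k)) (b k)| <=
  `|f - \sum_(0 <= k < n) bullet (h k) (b k)|.
Proof.
move=> nm; rewrite -(@ler_pXn2r _ 2%N)// ?nnegrE//.
rewrite [leLHS]dist_bracket_sum [leRHS]dist_bullet_sum.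
apply: (@le_trans _ _ (`|f| ^+ 2 - \sum_(0 <= k < n) `|bracket f (b k)| ^+ 2)).
  rewrite lerD2l lerN2 [leRHS](big_cat_nat (leq0n n) nm) lerDl.
  by apply: sumr_ge0 => k _; exact: exprn_ge0.
by rewrite lerDl; apply: sumr_ge0 => k _; exact: exprn_ge0.
Qed.

Lemma cvg_expansion (f : l2 H) :
  (forall e : R, 0 < e -> exists n (h : nat -> H),
     `|f - \sum_(0 <= k < n) bullet (h k) (b k)| <= e) ->
  series (fun k => bullet (bracket f (b k)) (b k)) @ \oo --> f.
Proof.
move=> fb; apply/cvgrPdist_le => e /fb[n [h nh]].
by exists n => // m /= nm; apply: le_trans nh; exact: bracket_sum_best.
Qed.

(** The squared remainder is exactly the gap in Bessel's inequality, so both tend to zero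
    together. *)
Lemma cvg_expansion_norm (f : l2 H) :
  series (fun k => bullet (bracket f (b k)) (b k)) @ \oo --> f <->
  series (fun k => `|bracket f (b k)| ^+ 2 : R) @ \oo --> (`|f| ^+ 2 : R).
Proof.
split=> [fb|/(@cvgrPdist_le R R^o) fb].
  set s := series _ in fb.
  rewrite (_ : series _ = fun n => `|f| ^+ 2 - `|f - s n| * `|f - s n|); last first.
    by apply/funext => n; rewrite -expr2 [X in _ - X]dist_bracket_sum subKr.
  have d0 : (fun n => `|f - s n|) @ \oo --> (0 : R).
    rewrite -(normr0 (l2 H)) -(subrr f).
    by apply: cvg_norm; exact: cvgB (cvg_cst _) fb.
  (* The limit takes the form |f|^2 - 0 * 0, matching the sequence. *)
  rewrite -[X in _ --> X]subr0 -[X in _ --> _ - X](mulr0 (0 : R)).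
  by apply: (@cvgB _ R^o); [exact: cvg_cst|exact: cvgM].
apply/cvgrPdist_le => e e0.
have e2 : 0 < e ^+ 2 by exact: exprn_gt0.
apply: filterS (fb _ e2) => n fn.
rewrite -(@ler_pXn2r _ 2%N)// ?nnegrE ?(ltW e0)// [leLHS]dist_bracket_sum.
exact: le_trans (ler_norm _) fn.
Qed.

Lemma cvg_expansionD (f g : l2 H) :
  series (fun k => bullet (bracket f (b k)) (b k)) @ \oo --> f ->
  series (fun k => bullet (bracket g (b k)) (b k)) @ \oo --> g ->
  series (fun k => bullet (bracket (f + g) (b k)) (b k)) @ \oo --> f + g.
Proof.
move=> fb gb; apply: cvg_expansion => e e0.
have fgb : series (fun k => bullet (bracket f (b k)) (b k)) \+
    series (fun k => bullet (bracket g (b k)) (b k)) @ \oo --> f + g.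
  exact: cvgD.
have /cvgrPdist_le/(_ _ e0)/filter_ex[n hn] := fgb.
(* The two partial sums add up to one admissible competitor, so best approximation applies
   directly. *)
exists n, (fun k => bracket f (b k) + bracket g (b k)).
by under eq_bigr do rewrite bulletDl; rewrite big_split.
Qed.

Lemma cvg_expansion_bullet (h : H) (x : l2 R^o) : dense (linear_span b) ->
  series (fun k => bullet (bracket (bullet h x) (b k)) (b k)) @ \oo -->
  bullet h x.
Proof.
move=> b_dense; apply: cvg_expansion => e e0.
have h1 : 0 < `|h| + 1 by rewrite ltr_wpDl.
have e1 : 0 < e / (`|h| + 1) by rewrite divr_gt0.
have [||y [xy [n [c yE]]]] := b_dense (ball x (e / (`|h| + 1))).
- by exists x; exact: ballxx.
- exact: ball_open.
(* The scalars of [y] move onto [h], so the sum is [bullet h y], at distance |h| |x - y| from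
   [bullet h x]. *)
exists n, (fun k => c k *: h).
rewrite -bullet_sumr -yE -bulletBr norm_bullet.
move: xy; rewrite -ball_normE/= ltr_pdivlMr// => /ltW; apply: le_trans.
by rewrite mulrC ler_wpM2l// lerDl.
Qed.

Lemma cvg_expansion_sum (h : nat -> H) (x : nat -> l2 R^o) n :
  dense (linear_span b) -> let f := \sum_(0 <= j < n) bullet (h j) (x j) in
  series (fun k => bullet (bracket f (b k)) (b k)) @ \oo --> f.
Proof.
move=> b_dense /=; elim: n => [|n ih].
  apply: cvg_expansion => e e0; exists 0%N, (fun=> 0).
  by rewrite !big_geq// subrr normr0 ltW.
rewrite big_nat_recr//=; apply: cvg_expansionD => //.
exact: cvg_expansion_bullet.
Qed.

End Orthonormal.

Section StandardBasis.
Variable R : realType.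

Let delta_sqsummable (j : nat) :
  (fun k => (k == j)%:R : R^o) \in @sqsummable R R^o.
Proof.
apply/sqsummableP; apply: (@cvgP R^o).
by apply: (cvg_series_single _ _ _ j) => k /negbTE ->; rewrite normr0 expr0n.
Qed.

Definition l2_delta (j : nat) : l2 R^o := L2 (delta_sqsummable j).

Lemma bracket_delta (H : hilbertType R) (f : l2 H) j : bracket f (l2_delta j) = f j.
Proof.
have := cvg_series_single _ _ (fun k => l2_delta j k *: f k) j.
rewrite /= eqxx scale1r => h; apply: cvg_lim => //; apply: h => k /negbTE ->.
exact: scale0r.
Qed.

Lemma l2_delta_orthonormal i j : inner (l2_delta i) (l2_delta j) = (i == j)%:R.
Proof.
rewrite l2_innerE; apply: (@cvg_lim R^o) => //.
have := cvg_series_single _ R^o (fun k => inner (l2_delta i k) (l2_delta j k)) j.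
rewrite /inner/= /real_inner eqxx mulr1 eq_sym; apply => k /negbTE ->.
exact: mulr0.
Qed.

Lemma cvg_delta_expansion (H : hilbertType R) (f : l2 H) :
  series (fun j => bullet (f j) (l2_delta j)) @ \oo --> f.
Proof.
rewrite (_ : (fun j => _) =
    fun j => bullet (bracket f (l2_delta j)) (l2_delta j)); last first.
  by apply/funext => j; rewrite bracket_delta.
(* Since the coefficients are the [f j], the norm criterion reduces to the series formula for the
   norm of [f]. *)
apply/(cvg_expansion_norm _ _ _ l2_delta_orthonormal).
under eq_fun do rewrite bracket_delta.
by rewrite l2_normE; exact: is_cvg_l2_norm.
Qed.

End StandardBasis.

Theorem theorem1p13 (R : realType) (H : hilbertType R)
    (H_separable : separable H) (H_infinite : ~ finite_dimensional H)
    (b : nat -> l2 R^o) (b_onb : orthonormal_basis b) (f : l2 H) :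
  series (fun k => bullet (bracket f (b k)) (b k)) @ \oo --> f /\
  series (fun k => `|bracket f (b k)| ^+ 2) @ \oo --> `|f| ^+ 2.
Proof.
have [b_on b_dense] := b_onb.
suff fb : series (fun k => bullet (bracket f (b k)) (b k)) @ \oo --> f.
  by split=> //; exact/cvg_expansion_norm.
(* One half of [e] pays for truncating [f] to its first [m] coordinates, the other for expanding the
   truncation [g] along [b]. *)
apply: cvg_expansion => // e e0; have e2 : 0 < e / 2 by rewrite divr_gt0.
have /cvgrPdist_le/(_ _ e2)/filter_ex[m fm] := cvg_delta_expansion _ _ f.
set g := series _ m in fm.
have /cvgrPdist_le/(_ _ e2)/filter_ex[n gn] :=
  cvg_expansion_sum _ _ _ b_on f (l2_delta R) m b_dense.
(* The competitor uses the coefficients of [g]; best approximation passes from it to those of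
   [f]. *)
exists n, (fun k => bracket g (b k)).
rewrite [e]splitr -(subrKA g); apply: le_trans (ler_normD _ _) _.
exact: lerD.
Qed.
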